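(* We can approximate the solution $[\rho]=(I-\Delta tA)^{-1}[G]$ of the system $(I-\Delta tA)[\rho]=[G]$ with $[\rho^*]$ using only matrix-vector products: $$[\rho^*]=\sum_{k=0}^N A[G_k]\,\Delta t^k,$$ where $$\forall k>0,\quad [G_k]=A[G_{k-1}],\qquad\text{and}\qquad A[G_0]=[G].$$
   Context: $U=\{x_1,\dots,x_n\}\subset\mathbb{R}^d$ is a set of pairwise distinct nodes, $\alpha>0$, and $\Phi_\alpha(x)=\phi(\|x\|_d/\alpha)$ is a differentiable radial basis function ($\|\cdot\|_d$ the Euclidean norm) such that the matrix $[\Phi_\alpha]=(\Phi_\alpha(x_i-x_j))_{1\le i,j\le n}$ is invertible. The nodal radial basis functions are $\Psi_{\alpha,x_j}(x)=\sum_{i=1}^n\Omega_{ij}\Phi_\alpha(x_i-x)$, with $\Omega_{ij}$ the entries of $[\Phi_\alpha]^{-1}$. The matrix $A$ is the $n\times n$ matrix with entries $$A_{ij}=-\sum_{k}u_{k,j}\,\partial_k\Psi_{\alpha,x_j}(x_i),$$ where $\partial_k$ is the partial derivative along direction $k$, the sum runs over the $d$ spatial directions, and $u_{k,j}$ is the $k$-th component of the velocity $\overrightarrow{u}$ at the node $x_j$. $I$ is the $n\times n$ identity matrix, $\Delta t$ is the time step, and $N$ is the order at which the series is truncated. The system $(I-\Delta tA)[\rho]=[G]$ is the discretization on $U$, by nodal radial basis functions in space and the backward Euler scheme in time, of the advection equation $\frac{\partial\rho}{\partial t}+\overrightarrow{\nabla}\cdot(\rho\overrightarrow{u})=S$ with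 mass density $\rho$ and source $S$; $[\rho]$ is the vector of values of $\rho$ at the nodes at the current time, and $[G]$ is the vector of nodal values of $G=\rho_{-\Delta t}+S\Delta t$, where $\rho_{-\Delta t}$ is the solution at the previous time step. *)

(* Defs.v *)
From HB Require Import structures.
From mathcomp Require Import all_boot all_order all_algebra.
From mathcomp Require Import all_classical all_reals all_analysis.
From mathcomp Require Import complex.
Import Order.TTheory GRing.Theory Num.Theory numFieldNormedType.Exports.

Set Implicit Arguments.
Unset Strict Implicit.
Unset Printing Implicit Defensive.

Local Open Scope classical_set_scope.
Local Open Scope ring_scope.

(* The library's norm on 'rV[R]_d is the sup norm (it induces the same
   topology, hence the same notion of differentiability), so the Euclidean
   norm has to be introduced separately. *)
Definition enorm (R : realType) (d : nat) (y : 'rV[R]_d) : R :=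
  Num.sqrt (\sum_(k < d) y 0 k ^+ 2).

Definition rbf (R : realType) (d : nat) (phi : R -> R) (alpha : R)
    (y : 'rV[R]_d) : R :=
  phi (enorm y / alpha).

Definition rbf_mx (R : realType) (d n : nat) (phi : R -> R) (alpha : R)
    (x : 'I_n -> 'rV[R]_d) : 'M[R]_n :=
  \matrix_(i, j) rbf phi alpha (x i - x j).

Definition nodal_rbf (R : realType) (d n : nat) (phi : R -> R) (alpha : R)
    (x : 'I_n -> 'rV[R]_d) (j : 'I_n) (y : 'rV[R]_d) : R :=
  \sum_(i < n) invmx (rbf_mx phi alpha x) i j * rbf phi alpha (x i - y).

(* The velocity u is evaluated at the column node x_j, the partial derivatives
   of the j-th nodal function at the row node x_i. *)
Definition advection_mx (R : realType) (d n : nat) (phi : R -> R) (alpha : R)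
    (x : 'I_n -> 'rV[R]_d) (u : 'rV[R]_d -> 'rV[R]_d) : 'M[R]_n :=
  \matrix_(i, j)
    - \sum_(k < d)
        u (x j) 0 k * 'D_(delta_mx 0 k) (nodal_rbf phi alpha x j) (x i).

Definition nodal_values (R : realType) (d n : nat) (x : 'I_n -> 'rV[R]_d)
    (f : 'rV[R]_d -> R) : 'cV[R]_n :=
  \col_i f (x i).

Definition euler_rhs (R : realType) (d : nat) (rho_prev S : 'rV[R]_d -> R)
    (dt : R) (y : 'rV[R]_d) : R :=
  rho_prev y + S y * dt.

Definition euler_mx (R : realType) (n : nat) (A : 'M[R]_n) (dt : R) : 'M[R]_n :=
  1%:M - dt *: A.

Definition euler_solution (R : realType) (n : nat) (A : 'M[R]_n)
    (G : 'cV[R]_n) (dt : R) : 'cV[R]_n :=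
  invmx (euler_mx A dt) *m G.

(* The recurrence A [G_0] = [G] and [G_k] = A [G_(k-1)] for k > 0. *)
Definition G_recurrence (R : realType) (n : nat) (A : 'M[R]_n) (G : 'cV[R]_n)
    (Gs : nat -> 'cV[R]_n) : Prop :=
  A *m Gs 0%N = G /\ forall k : nat, (0 < k)%N -> Gs k = A *m Gs k.-1.

(* AG A G k is the vector A [G_k]. The recurrence determines it by matrix-vector
   products started at A [G_0] = [G]; the vector [G_0] itself never enters, and
   need not exist when A is singular. *)
Fixpoint AG (R : realType) (n : nat) (A : 'M[R]_n) (G : 'cV[R]_n) (k : nat)
    : 'cV[R]_n :=
  if k is k'.+1 then A *m AG A G k' else G.

Definition rho_star (R : realType) (n : nat) (A : 'M[R]_n) (G : 'cV[R]_n)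
    (dt : R) (N : nat) : 'cV[R]_n :=
  \sum_(k < N.+1) dt ^+ k *: AG A G k.

(* The spectral radius of M is less than 1, the eigenvalues being complex. This
   is implied by M having norm less than 1 for any operator norm. *)
Definition spectral_radius_lt1 (R : realType) (n : nat) (M : 'M[R]_n) : Prop :=
  forall lambda : R[i],
    eigenvalue (map_mx (real_complex R) M) lambda -> `|lambda| < 1.

(* Main.v *)
(* With M = dt A, the terms dt^k A[G_k] are M^k G, so rho* is a partial sum of
   the Neumann series of (1 - M)^-1 G and the error is (1 - M)^-1 M^(N+1) G.
   For small dt, M contracts by a factor 1/2, which makes 1 - M invertible with
   inverse of norm at most 2. For fixed dt, Cayley-Hamilton over the complex
   numbers factors the annihilator of M as a product of M - a with |a| < 1;
   removing the factors one at a time shows that M^k G decays geometrically. *)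
Require Import Defs.
From HB Require Import structures.
From mathcomp Require Import all_boot all_order all_algebra.
From mathcomp Require Import all_classical all_reals all_analysis.
From mathcomp Require Import complex ring lra.
Import Order.TTheory GRing.Theory Num.Theory numFieldNormedType.Exports.
Local Open Scope classical_set_scope.
Local Open Scope ring_scope.

Set Implicit Arguments.
Unset Strict Implicit.

(** * Entrywise sup norm of matrices *)

Lemma ler_entry_mx_norm (K : numFieldType) (m n : nat) (M : 'M[K]_(m, n)) i j :
  `|M i j| <= `|M|.
Proof.
rewrite [leRHS]/Num.Def.normr /= mx_normE.
exact: (le_bigmax _ (fun i : 'I_m * 'I_n => (`|M i.1 i.2|%:nng)%R) (i, j)).
Qed.

Lemma mx_norm_le (K : realFieldType) (m n : nat) (M : 'M[K]_(m, n)) (c : K) :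
  0 <= c -> (forall i j, `|M i j| <= c) -> `|M| <= c.
Proof.
move=> c0 Mc; rewrite [leLHS]/Num.Def.normr /= mx_normrE.
by apply: bigmax_le => // -[i j] _; exact: Mc.
Qed.

(** The sup norm is not submultiplicative: each entry of the product is a sum of [n] terms, whence
    the factor [n]. *)
Lemma mx_norm_mulmx (K : realFieldType) (m n p : nat)
    (A : 'M[K]_(m, n)) (B : 'M[K]_(n, p)) :
  `|A *m B| <= n%:R * `|A| * `|B|.
Proof.
apply: mx_norm_le => [|i j]; first by rewrite !mulr_ge0.
rewrite mxE (le_trans (ler_norm_sum _ _ _))//.
have -> : n%:R * `|A| * `|B| = \sum_(k < n) `|A| * `|B|.
  by rewrite sumr_const card_ord -mulrA mulr_natl.
by apply: ler_sum => k _; rewrite normrM ler_pM// ler_entry_mx_norm.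
Qed.

(** * Truncated series and its exact error *)

Lemma AG_recurrence (R : realType) (n : nat) (A : 'M[R]_n) (G : 'cV[R]_n) Gs k :
  G_recurrence A G Gs -> AG A G k = A *m Gs k.
Proof. by case=> G0 GS; elim: k => [//|k IH] /=; rewrite IH (GS k.+1). Qed.

Lemma AG_scale (R : realType) (n : nat) (A : 'M[R]_n) (G : 'cV[R]_n) dt k :
  dt ^+ k *: AG A G k = AG (dt *: A) G k.
Proof.
elim: k => [|k IH] /=; first by rewrite expr0 scale1r.
by rewrite -IH -!scalemxAl -!scalemxAr scalerA exprS.
Qed.

Lemma euler_mx_rho_star (R : realType) (n : nat) (A : 'M[R]_n) (G : 'cV[R]_n) dt N :
  euler_mx A dt *m rho_star A G dt N = G - AG (dt *: A) G N.+1.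
Proof.
rewrite /rho_star; under eq_bigr do rewrite AG_scale.
(* The sum telescopes: each new term cancels the previous remainder and leaves the next power. *)
elim: N => [|N IH]; first by rewrite big_ord1 mulmxBl mul1mx.
by rewrite big_ord_recr /= mulmxDr IH mulmxBl mul1mx /= addrA subrK.
Qed.

Lemma euler_error (R : realType) (n : nat) (A : 'M[R]_n) (G : 'cV[R]_n) dt N :
  euler_mx A dt \in unitmx ->
  euler_solution A G dt - rho_star A G dt N =
  invmx (euler_mx A dt) *m AG (dt *: A) G N.+1.
Proof.
move=> U; rewrite -[rho_star _ _ _ _](mulKmx U) euler_mx_rho_star.
by rewrite mulmxBr opprB addrC subrK.
Qed.

Lemma AG_norm_le (R : realType) (n : nat) (A : 'M[R]_n) (G : 'cV[R]_n) k :
  `|AG A G k| <= (n%:R * `|A|) ^+ k * `|G|.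
Proof.
elim: k => [|k IH] /=; first by rewrite mul1r.
rewrite (le_trans (mx_norm_mulmx _ _))// exprS -[leRHS]mulrA.
by rewrite ler_wpM2l// mulr_ge0.
Qed.

(** * Error bound for small time steps *)

Lemma euler_mx_expansive (R : realType) (n p : nat) (A : 'M[R]_n) (dt : R)
    (V : 'M[R]_(n, p)) :
  n%:R * `|dt *: A| <= 2^-1 -> `|V| <= 2 * `|euler_mx A dt *m V|.
Proof.
move=> h; rewrite mulmxBl mul1mx.
have h1 := le_trans (mx_norm_mulmx (dt *: A) V) (ler_wpM2r (normr_ge0 V) h).
(* Reverse triangle inequality: subtracting [(dt *: A) *m V] costs at most half of [|V|]. *)
have := lerB_dist V ((dt *: A) *m V).
lra.
Qed.

(** [kermx] is a left kernel, so it is taken for the transpose of [B]: its rows, transposed, are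
    vectors killed by [B]. *)
Lemma unitmx_mulmx_inj (K : fieldType) (n : nat) (B : 'M[K]_n) :
  (forall v : 'cV[K]_n, B *m v = 0 -> v = 0) -> B \in unitmx.
Proof.
move=> inj; rewrite -unitmx_tr -row_free_unit -kermx_eq0.
apply/eqP/row_matrixP => i; rewrite row0.
apply: trmx_inj; rewrite trmx0; apply: inj.
by rewrite -{1}[B]trmxK -trmx_mul -row_mul mulmx_ker row0 trmx0.
Qed.

Lemma small_euler_mx_unit (R : realType) (n : nat) (A : 'M[R]_n) (dt : R) :
  n%:R * `|dt *: A| <= 2^-1 -> euler_mx A dt \in unitmx.
Proof.
move=> h; apply: unitmx_mulmx_inj => v v0.
have := euler_mx_expansive v h.
by rewrite v0 normr0 mulr0 normr_le0 => /eqP.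
Qed.

Lemma euler_truncation_error (R : realType) (n : nat) (A : 'M[R]_n)
    (G : 'cV[R]_n) (dt : R) (N : nat) :
  0 <= dt -> n%:R * `|dt *: A| <= 2^-1 ->
  `|euler_solution A G dt - rho_star A G dt N|
    <= 2 * (n%:R * `|A|) ^+ N.+1 * dt ^+ N.+1 * `|G|.
Proof.
move=> dt0 h; have U := small_euler_mx_unit h.
(* Expansiveness is applied to the error itself, so the inverse cancels and its norm is never
   estimated. *)
apply: le_trans (euler_mx_expansive _ h) _.
rewrite euler_error// mulKVmx// -!mulrA ler_pM2l// -AG_scale.
rewrite normrZ normrX (ger0_norm dt0) mulrCA ler_wpM2l ?exprn_ge0//.
exact: AG_norm_le.
Qed.

(** * Geometric decay of orbits *)

Lemma le_geometric_recurrence (K : numFieldType) (r rho C : K) (b : nat -> K) :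
  0 <= r -> r < rho -> 0 <= C -> (forall k, 0 <= b k) ->
  (forall k, b k.+1 <= r * b k + C * rho ^+ k) ->
  forall k, b k <= (b 0%N + C / (rho - r)) * rho ^+ k.
Proof.
move=> r0 rrho C0 b0 bS.
have d0 : 0 < rho - r by rewrite subr_gt0.
have rho0 : 0 <= rho by apply: le_trans (ltW rrho).
elim=> [|k IH]; first by rewrite mulr1 lerDl divr_ge0// ltW.
apply: le_trans (bS k) _; apply: (le_trans (lerD (ler_wpM2l r0 IH) (lexx _))).
rewrite exprS !mulrA -mulrDl ler_wpM2r ?exprn_ge0//.
rewrite [r * _]mulrC -[leRHS]mulr1 -subr_ge0.
(* [D = C / (rho - r)] solves [r * D + C = rho * D], so the only slack left comes from the initial
   value [b 0]. *)
have -> : (b 0%N + C / (rho - r)) * rho * 1 - ((b 0%N + C / (rho - r)) * r + C)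
   = b 0%N * (rho - r) by field; rewrite lt0r_neq0.
by rewrite mulr_ge0// ltW.
Qed.

(* Peeling off one factor M - a turns the orbit of w into a solution of
   v (k+1) = a v k + e k, where e is the orbit of (M - a) w. *)
Lemma orbit_geometric_bound (K : numFieldType) (n : nat) (M : 'M[K]_n.+1)
    (s : seq K) (rho : K) (w : 'cV[K]_n.+1) :
  0 < rho -> (forall a, a \in s -> `|a| < rho) ->
  (\prod_(a <- s) (M - a%:M)) *m w = 0 ->
  exists2 C : K, 0 <= C & forall k, `|iter k (mulmx M) w| <= C * rho ^+ k.
Proof.
move=> rho0; elim: s w => [|a s IH] w hs.
  rewrite big_nil mul1mx => ->; exists 0 => // k; rewrite mul0r.
  suff -> : iter k (mulmx M) (0 : 'cV_n.+1) = 0 by rewrite normr0.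
  by elim: k => //= k ->; rewrite mulmx0.
(* Moving the factor of [a] to the right lets the induction hypothesis apply to
   [(M - a%:M) *m w]. *)
have comm : (M - a%:M) *m (\prod_(b <- s) (M - b%:M)) =
            (\prod_(b <- s) (M - b%:M)) *m (M - a%:M).
  apply: (@commr_prod 'M[K]_n.+1) => b _.
  apply: comm_mxB; last exact: comm_mx_scalar.
  by apply: comm_mx_sym; apply: comm_mxB => //; exact: comm_mx_scalar.
rewrite big_cons -mulmxE comm -mulmxA => /IH[b bs|C C0 hC].
  by apply: hs; rewrite inE bs orbT.
have ar : `|a| < rho by apply: hs; rewrite inE eqxx.
exists (`|w| + C / (rho - `|a|)) => [|k].
  by rewrite addr_ge0// divr_ge0// subr_ge0 ltW.
apply: (@le_geometric_recurrence _ `|a| rho C (fun k => `|iter k (mulmx M) w|)) => // {}k.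
have -> : iter k.+1 (mulmx M) w =
   a *: iter k (mulmx M) w + iter k (mulmx M) ((M - a%:M) *m w).
  elim: k => [|k IHk] /=; first by rewrite mulmxBl mul_scalar_mx addrC subrK.
  by rewrite scalemxAr -mulmxDr -IHk.
by rewrite (le_trans (ler_normD _ _))// normrZ lerD2l.
Qed.

Lemma lt1_common_bound (K : numFieldType) (s : seq K) :
  (forall a, a \in s -> `|a| < 1) ->
  exists2 rho : K, 0 < rho < 1 & forall a, a \in s -> `|a| < rho.
Proof.
elim: s => [|a s IH] hs.
  by exists 2^-1 => //; rewrite invr_gt0 ltr0n invf_lt1 ?ltr1n ?ltr0n.
have [b bs|rho /andP[r0 r1] hr] := IH; first by apply: hs; rewrite inE bs orbT.
have [a0 a1] := (normr_ge0 a, hs a (mem_head _ _)).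
(* [c] is the maximum of [rho] and [|a|], comparable since both are real; its midpoint with 1 then
   makes the bounds strict. *)
have : exists2 c, rho <= c < 1 & `|a| <= c.
  have := real_leP (normr_real a) (gtr0_real r0) => -[?|/ltW?].
    by exists rho; rewrite ?lexx.
  by exists `|a| => //; apply/andP.
move=> [c /andP[rc c1] ac].
have [cm m1] := (midf_lt c1); exists ((c + 1) / 2).
  by rewrite m1 (lt_trans (lt_le_trans r0 rc)).
move=> b; rewrite inE => /predU1P[->|/hr br]; first exact: le_lt_trans cm.
exact: lt_trans (lt_le_trans br rc) cm.
Qed.

Lemma spectral_AG_geometric (R : realType) (n : nat) (M : 'M[R]_n) (w : 'cV[R]_n) :
  spectral_radius_lt1 M ->
  exists C rho : R, 0 < rho < 1 /\ forall k, `|AG M w k| <= C * rho ^+ k.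
Proof.
case: n M w => [|n] M w hM.
  exists 0, 2^-1; split; first by rewrite invr_gt0 ltr0n invf_lt1 ?ltr1n.
  by move=> k; rewrite mul0r (flatmx0 (AG _ _ _)) normr0.
pose Mc : 'M[R[i]]_n.+1 := map_mx (real_complex R) M.
have [s] := closed_field_poly_normal (char_poly Mc).
rewrite (monicP (char_poly_monic _)) scale1r => sE.
have : forall a, a \in s -> `|a| < 1.
  move=> a sa; apply: hM; rewrite eigenvalue_root_char -/Mc sE.
  by rewrite root_prod_XsubC.
move=> /lt1_common_bound[rho /andP[r0 r1] hs].
have prod0 : \prod_(a <- s) (Mc - a%:M) = 0.
  rewrite -(Cayley_Hamilton Mc) sE rmorph_prod; apply: eq_bigr => a _.
  by rewrite rmorphB /= horner_mx_X horner_mx_C.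
pose wc : 'cV[R[i]]_n.+1 := map_mx (real_complex R) w.
have [|C C0 hC] := @orbit_geometric_bound _ _ Mc s rho wc r0 hs.
  by rewrite prod0 mul0mx.
(* The constants live in [R[i]] but are nonnegative, hence real, and the bound descends to [R] entry
   by entry. *)
have /complex_realP[c CE] := ger0_real C0.
have /complex_realP[q qE] := gtr0_real r0.
exists c, q; split; first by rewrite -!ltcR -qE r0.
have iterE k : iter k (mulmx Mc) wc = map_mx (real_complex R) (AG M w k).
  by elim: k => //= k ->; rewrite map_mxM.
have bound k i j : `|AG M w k i j| <= c * q ^+ k.
  have := le_trans (ler_entry_mx_norm (iter k (mulmx Mc) wc) i j) (hC k).
  rewrite iterE mxE CE qE -rmorphXn -rmorphM normc_def /= expr0n addr0 sqrtr_sqr.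
  by rewrite lecR.
move=> k; apply: mx_norm_le => //.
(* Nonnegativity of the bound is read off one entry. *)
exact: le_trans (bound k ord0 ord0).
Qed.

(** * Convergence for a fixed time step *)

Lemma spectral_euler_mx_unit (R : realType) (n : nat) (A : 'M[R]_n) (dt : R) :
  spectral_radius_lt1 (dt *: A) -> euler_mx A dt \in unitmx.
Proof.
move=> hM; apply: contraT => nU.
(* If [1 - dt *: A] were singular, 1 would be an eigenvalue of [dt *: A]. *)
suff : `|1 : R[i]| < 1 by rewrite normr1 ltxx.
apply: hM; rewrite -(rmorph1 (real_complex R)) eigenvalue_map /eigenvalue kermx_eq0.
by rewrite row_free_unit -opprB -scaleN1r unitmxZ ?unitrN1.
Qed.

Lemma rho_star_cvg (R : realType) (n : nat) (A : 'M[R]_n) (G : 'cV[R]_n) (dt : R) :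
  spectral_radius_lt1 (dt *: A) ->
  rho_star A G dt N @[N --> \oo] --> euler_solution A G dt.
Proof.
move=> hM; have U := spectral_euler_mx_unit hM.
have [C [rho [/andP[r0 r1] hC]]] := spectral_AG_geometric G hM.
(* The extra [rho] absorbs the shift from [N] to the exponent [N.+1] of the remainder. *)
pose D := n%:R * `|invmx (euler_mx A dt)| * (C * rho).
apply/cvgrPdist_le => e e0.
have /cvgr0Pnorm_le /(_ e e0) : geometric D rho @ \oo --> (0 : R).
  by apply: cvg_geometric; rewrite ger0_norm ?ltW.
apply: filterS => N /= hN; rewrite euler_error//.
apply: le_trans (mx_norm_mulmx _ _) _; apply: le_trans hN.
apply: le_trans (ler_norm _); rewrite /D /geometric /= -[leRHS]mulrA.
rewrite ler_wpM2l ?mulr_ge0//.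
by rewrite -mulrA -exprS; exact: (hC N.+1).

Qed.

Unset Implicit Arguments.
Set Strict Implicit.

Theorem theorem4 (R : realType) (d n : nat) (x : 'I_n -> 'rV[R]_d)
    (phi : R -> R) (alpha : R) (u : 'rV[R]_d -> 'rV[R]_d)
    (hx : injective x) (halpha : 0 < alpha)
    (hdiff : forall y : 'rV[R]_d, differentiable (rbf phi alpha : 'rV[R]_d -> R) y)
    (hinv : rbf_mx phi alpha x \in unitmx) :
  let A := advection_mx phi alpha x u in
  [/\ (* [rho*] is the sum of the statement, for all vectors [G_k] *)
      forall (G : 'cV[R]_n) (Gs : nat -> 'cV[R]_n) (dt : R) (N : nat),
        G_recurrence A G Gs ->
        rho_star A G dt N = \sum_(k < N.+1) dt ^+ k *: (A *m Gs k),
      (* truncation at order N: the error is O(dt ^ (N + 1)) as dt -> 0 *)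
      exists2 delta : R, 0 < delta &
        forall N : nat, exists C : R,
        forall (dt : R) (rho_prev S : 'rV[R]_d -> R), 0 < dt < delta ->
          let G := nodal_values x (euler_rhs rho_prev S dt) in
          euler_mx A dt \in unitmx /\
          `|euler_solution A G dt - rho_star A G dt N|
            <= C * dt ^+ N.+1 * `|G|
    & (* fixed time step: convergence as N -> oo *)
      forall (dt : R) (rho_prev S : 'rV[R]_d -> R), 0 < dt ->
        spectral_radius_lt1 (dt *: A) ->
        let G := nodal_values x (euler_rhs rho_prev S dt) in
        euler_mx A dt \in unitmx /\
        rho_star A G dt N @[N --> \oo] --> euler_solution A G dt].
Proof.
move=> A; split=> [G Gs dt N hG||dt rho_prev S _ hM G].
- by apply: eq_bigr => k _; rewrite (AG_recurrence _ hG).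
(* This choice forces [n * |dt *: A| <= 1/2] for every [N]; the [+ 1] keeps the denominator positive
   when [A = 0]. *)
- exists (2 * (n%:R * `|A| + 1))^-1.
    by rewrite invr_gt0 mulr_gt0// ltr_wpDl// mulr_ge0.
  move=> N; exists (2 * (n%:R * `|A|) ^+ N.+1) => dt rho_prev S /andP[dt0 dtd] G.
  have a0 : 0 <= n%:R * `|A| by rewrite mulr_ge0.
  have h : n%:R * `|dt *: A| <= 2^-1.
    rewrite normrZ gtr0_norm// mulrCA.
    move: dtd; rewrite -[_^-1]mul1r ltr_pdivlMr; last by lra.
    lra.
  split; first exact: small_euler_mx_unit.
  exact: euler_truncation_error (ltW dt0) h.
- by split; [exact: spectral_euler_mx_unit | exact: rho_star_cvg].
Qed.
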